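(* Let $k$ be a field and let $\nu:k(x,y,z)\to\mathbb{Q}$ be the valuation dominating $k[x,y,z]_{(x,y,z)}$ with $\nu(P_i)=\beta_i$ for all $i\ge0$ and $\nu(Q_i)=\bar\gamma_i$ for all $i\ge1$, where the polynomials $P_i,Q_i$ and the values $\beta_i,\bar\gamma_i$ are those specified in the context. Then the value semigroup $\nu(k[x,y,z]_{(x,y,z)}\setminus\{0\})$ is the semigroup generated by $$\{1,\ 1\tfrac12,\ 2\tfrac14,\ 4\tfrac58,\dots\}\cup\{4\tfrac13,\ 13\tfrac19,\ 39\tfrac{10}{27},\dots\},$$ that is, by $\{1,\tfrac32\}\cup\{\beta_{i+1}-2^{i-1}\mid i\ge1\}\cup\{\bar\gamma_i\mid i\ge2\}$.
   Context: Values: $\beta_0=1$, $\beta_1=\frac32$, and $\beta_i=2\beta_{i-1}+\frac1{2^i}$ for $i>1$ (so $\beta_2=3\frac14$, $\beta_3=6\frac58$, ...); $\bar\gamma_1=2\frac14$, $\bar\gamma_2=4\frac13$, and $\bar\gamma_{i+1}=3\bar\gamma_i+\frac1{3^i}$ for $i>1$ (so $\bar\gamma_3=13\frac19$, $\bar\gamma_4=39\frac{10}{27}$, ...). Polynomials in $k[x,y,z]$: $P_0=x$, $P_1=y$, $P_2=y^2-x^3$, $P_i=P_{i-1}^2-x^{5\cdot2^{i-3}}P_{i-2}$ for $i>2$; $Q_1=z$, $Q_2=xz-P_2$, $Q_3=Q_2^3-x^{13}$, $Q_{i+1}=Q_i^3-x^{35\cdot3^{i-3}}Q_{i-1}$ for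 $i>2$. These data determine a unique valuation $\nu:k(x,y,z)\to\mathbb{Q}$ dominating $k[x,y,z]_{(x,y,z)}$ (i.e. nonnegative on this local ring and positive exactly on its maximal ideal) with $\nu(P_i)=\beta_i$ and $\nu(Q_i)=\bar\gamma_i$. The semigroup generated by a set means the set of all finite linear combinations of its elements with nonnegative integer coefficients (including $0$). The numbers $\beta_{i+1}-2^{i-1}$, $i\ge1$, are the values $\nu(R_i)$ of the polynomials $R_1=z$, $R_2=R_1^2-x^3P_1$, $R_i=R_{i-1}^2-x^{3\cdot2^{i-2}}P_{i-1}$ for $i>2$. *)

(* Defs.v *)
From HB Require Import structures.
From mathcomp Require Import all_boot all_algebra.
From mathcomp Require Import mpoly.

Set Implicit Arguments.
Unset Strict Implicit.
Unset Printing Implicit Defensive.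

Import GRing.Theory.
Local Open Scope ring_scope.

Fixpoint beta (i : nat) : rat :=
  match i with
  | 0 => 1
  | 1 => 3 / 2
  | j.+1 => 2 * beta j + (2 ^+ i)^-1
  end.

(* The sequence starts at i = 1; the value at 0 is a dummy. *)
Fixpoint gammabar (i : nat) : rat :=
  match i with
  | 0 => 0
  | 1 => 9 / 4
  | 2 => 13 / 3
  | j.+1 => 3 * gammabar j + (3 ^+ j)^-1
  end.

Definition varx (k : fieldType) : {mpoly k[3]} := 'X_(@Ordinal 3 0 isT).
Definition vary (k : fieldType) : {mpoly k[3]} := 'X_(@Ordinal 3 1 isT).
Definition varz (k : fieldType) : {mpoly k[3]} := 'X_(@Ordinal 3 2 isT).

(* In the last branch the index is i = j + 3, so that 2 ^ j = 2 ^ (i - 3). *)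
Fixpoint Ppoly (k : fieldType) (i : nat) : {mpoly k[3]} :=
  match i with
  | 0 => varx k
  | 1 => vary k
  | 2 => vary k ^+ 2 - varx k ^+ 3
  | ((j.+1 as i2).+1 as i1).+1 =>
      Ppoly k i1 ^+ 2 - varx k ^+ (5 * 2 ^ j) * Ppoly k i2
  end.

(* The sequence starts at i = 1; the value at 0 is a dummy.  In the last branch
   the index is i + 1 = j + 4, so that 3 ^ j = 3 ^ (i - 3). *)
Fixpoint Qpoly (k : fieldType) (i : nat) : {mpoly k[3]} :=
  match i with
  | 0 => 0
  | 1 => varz k
  | 2 => varx k * varz k - Ppoly k 2
  | 3 => (varx k * varz k - Ppoly k 2) ^+ 3 - varx k ^+ 13
  | ((j.+2 as i2).+1 as i1).+1 =>
      Qpoly k i1 ^+ 3 - varx k ^+ (35 * 3 ^ j) * Qpoly k i2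
  end.

Definition ideal_xyz (k : fieldType) (p : {mpoly k[3]}) : Prop :=
  exists a b c : {mpoly k[3]}, p = a * varx k + b * vary k + c * varz k.

(* k[x,y,z]_(x,y,z), as a subset of its fraction field k(x,y,z). *)
Definition local_ring (k : fieldType) (f : {fraction {mpoly k[3]}}) : Prop :=
  exists p q : {mpoly k[3]},
    ~ ideal_xyz q /\ f = FracField.tofrac p / FracField.tofrac q.

Definition local_max_ideal (k : fieldType) (f : {fraction {mpoly k[3]}}) :
    Prop :=
  exists p q : {mpoly k[3]},
    [/\ ideal_xyz p, ~ ideal_xyz q
      & f = FracField.tofrac p / FracField.tofrac q].

(* A valuation is a map on the nonzero elements; nu 0 (mathematically +oo) is
   an unconstrained dummy. *)
Definition is_valuation (F : fieldType) (nu : F -> rat) : Prop :=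
  (forall f g : F, f != 0 -> g != 0 -> nu (f * g) = nu f + nu g) /\
  (forall f g : F, f != 0 -> g != 0 -> f + g != 0 ->
     Num.min (nu f) (nu g) <= nu (f + g)).

Definition dominates_local_ring (k : fieldType)
    (nu : {fraction {mpoly k[3]}} -> rat) : Prop :=
  forall f : {fraction {mpoly k[3]}}, f != 0 -> local_ring f ->
    0 <= nu f /\ (0 < nu f <-> local_max_ideal f).

Definition value_semigroup (k : fieldType)
    (nu : {fraction {mpoly k[3]}} -> rat) (s : rat) : Prop :=
  exists f : {fraction {mpoly k[3]}}, [/\ f != 0, local_ring f & s = nu f].

Definition semigroup_generated (S : rat -> Prop) (s : rat) : Prop :=
  exists l : seq (nat * rat),
    (forall c : nat * rat, c \in l -> S c.2) /\ s = \sum_(c <- l) c.2 *+ c.1.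

Definition generators (s : rat) : Prop :=
  [\/ s = 1, s = 3 / 2,
      exists2 i : nat, (1 <= i)%N & s = beta i.+1 - 2 ^+ i.-1
    | exists2 i : nat, (2 <= i)%N & s = gammabar i].

(* Main.v *)
Require Import Defs.
From mathcomp Require Import all_boot all_order all_algebra.
From mathcomp Require Import mpoly.
From mathcomp Require Import ring lra zify.

(** Write x, y, z for the variables, w = Q_2 = x z - y^2 + x^3, and R_0 = y,
    R_1 = z, R_(t+2) = R_(t+1)^2 - x^(3 2^t) P_(t+1).  The idea is to find a
    k-basis of k[x,y,z] consisting of the products
<<
      x^a * prod_i R_i^(e_i) * prod_j Q_(j+2)^(d_j),  e_i < 2, d_j < 3,
>>
    whose values are pairwise distinct and visibly lie in the semigroup of the
    theorem.  The value of a nonzero polynomial is then the smallest value among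
    its basis terms, hence it lies in that semigroup.

    The values are distinct because of their denominators: nu(R_i) is an odd
    integer over 2^(i+1), and nu(Q_(j+2)) is an integer prime to 3 over 3^(j+1),
    so each new R_i or Q_j has a value outside the group generated by the
    earlier ones, and remains outside it after multiplication by an admissible
    nonzero exponent.

    The products span because each R_i and Q_j has a leading term.  The relation
    y^2 = x z + x^3 - w shows that k[x,y,z] is spanned over k[x,w] by the
    monomials y^e z^b with e < 2; giving y weight 1 and z weight 2 there is
    exactly one such monomial of each weight n, and R_i is monic of weight 2^i
    ([Rpoly_leads]).  Likewise Q_(j+2) is monic in w of degree 3^j over k[x]
    ([Qpoly_leads]).  Division by a monic element ([span_division]) turns these
    leading terms into expansions in base 2 and 3.  The induction that combines
    division and distinctness of values is [tower_values]; it is used once over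
    k[x] with the Q_j and once over k[x,w] with the R_i.

    The value of R_(t+1) comes from the congruence
    x^(2^t) R_(t+1) = P_(t+2) + E with nu(E) > nu(P_(t+2)) ([Rpoly_Ppoly]),
    which starts from x z = P_2 + Q_2.  For the reverse inclusion, the
    generators of the semigroup are the values of x and of the R_i and Q_j. *)

Set Implicit Arguments.
Unset Strict Implicit.
Unset Printing Implicit Defensive.

Import Order.TTheory GRing.Theory Num.Theory.
Local Open Scope ring_scope.

(** * Filtered free modules and division *)

Section Span.
Variable D : comNzRingType.

(** Subrings are propositional predicates: membership in k[x] or k[x,w] is an
    existence statement, with no boolean test at hand. *)
Definition subring (B : D -> Prop) : Prop :=
  [/\ B 1, forall a b, B a -> B b -> B (a - b)
    & forall a b, B a -> B b -> B (a * b)].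

Definition span (B : D -> Prop) (g : nat -> D) (n : nat) (f : D) : Prop :=
  exists2 c : nat -> D, forall i, B (c i) & f = \sum_(i < n) c i * g i.

Definition adjoin (B : D -> Prop) (g : nat -> D) (f : D) : Prop :=
  exists n, span B g n f.

(** The index n is a weight: a product of generators of weights i and j has
    weight at most i + j. *)
Definition graded (B : D -> Prop) (g : nat -> D) : Prop :=
  g 0 = 1 /\ forall i j, span B g (i + j).+1 (g i * g j).

(** Being monic of weight q. *)
Definition leads (B : D -> Prop) (g : nat -> D) (q : nat) (b : D) : Prop :=
  span B g q (b - g q).

Variables (B : D -> Prop) (g : nat -> D).
Hypotheses (Bring : subring B) (ggr : graded B g).

Lemma subring1 : B 1. Proof. by case: Bring. Qed.

Lemma subringB a b : B a -> B b -> B (a - b).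
Proof. by case: Bring => _ + _; apply. Qed.

Lemma subringM a b : B a -> B b -> B (a * b).
Proof. by case: Bring => _ _; apply. Qed.

Lemma subring0 : B 0.
Proof. by rewrite -(subrr 1); apply: subringB; apply: subring1. Qed.

Lemma subringN a : B a -> B (- a).
Proof. by rewrite -sub0r; apply: subringB subring0. Qed.

Lemma subringD a b : B a -> B b -> B (a + b).
Proof. by move=> Ba Bb; rewrite -(opprK b); apply/subringB/subringN. Qed.

Lemma subringX a n : B a -> B (a ^+ n).
Proof.
move=> Ba; elim: n => [|n IH]; first by rewrite expr0; apply: subring1.
by rewrite exprS; apply: subringM.
Qed.

Lemma span0 n : span B g n 0.
Proof.
exists (fun=> 0) => [_|]; first exact: subring0.
by rewrite big1 // => i _; rewrite mul0r.
Qed.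

Lemma spanD n f h : span B g n f -> span B g n h -> span B g n (f + h).
Proof.
move=> [c Bc ->] [d Bd ->]; exists (fun i => c i + d i).
  by move=> i; apply: subringD.
by rewrite -big_split; apply: eq_bigr => i _; rewrite mulrDl.
Qed.

Lemma spanZ n a f : B a -> span B g n f -> span B g n (a * f).
Proof.
move=> Ba [c Bc ->]; exists (fun i => a * c i) => [i|]; first exact: subringM.
by rewrite mulr_sumr; apply: eq_bigr => i _; rewrite mulrA.
Qed.

Lemma spanN n f : span B g n f -> span B g n (- f).
Proof. by rewrite -mulN1r; apply/spanZ/subringN/subring1. Qed.

Lemma spanB n f h : span B g n f -> span B g n h -> span B g n (f - h).
Proof. by move=> Bf Bh; apply/spanD/spanN. Qed.

Lemma span_sum I (r : seq I) n (F : I -> D) :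
  (forall i, span B g n (F i)) -> span B g n (\sum_(i <- r) F i).
Proof. by move=> BF; apply: big_ind => //; [apply: span0|apply: spanD]. Qed.

Lemma span_gen n i : (i < n)%N -> span B g n (g i).
Proof.
move=> lt_in; exists (fun j => if j == i then 1 else 0) => [j|].
  by case: ifP => _; [apply: subring1|apply: subring0].
rewrite (bigD1 (Ordinal lt_in)) //= eqxx mul1r big1 ?addr0 // => j.
by rewrite -val_eqE /= => /negbTE ->; rewrite mul0r.
Qed.

Lemma span_le m n f : (m <= n)%N -> span B g m f -> span B g n f.
Proof.
move=> le_mn [c Bc ->]; apply: span_sum => i.
exact/spanZ/span_gen/(leq_trans (ltn_ord i)).
Qed.

Lemma span_coef n a : B a -> span B g n.+1 a.
Proof.
by case: ggr => g0 _ Ba; rewrite -(mulr1 a) -g0; apply/spanZ/span_gen.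
Qed.

Lemma spanM m n f h :
  span B g m f -> span B g n h -> span B g (m + n).-1 (f * h).
Proof.
case: ggr => _ gM [c Bc ->] [d Bd ->]; rewrite mulr_suml; apply: span_sum => i.
rewrite mulr_sumr; apply: span_sum => j; rewrite mulrACA.
apply/spanZ; first exact: subringM.
apply: span_le (gM i j); have := ltn_ord i; have := ltn_ord j; lia.
Qed.

Lemma adjoin_subring : subring (adjoin B g).
Proof.
split=> [|f h [m Bf] [n Bh]|f h [m Bf] [n Bh]].
- by exists 1; apply/span_coef/subring1.
- exists (m + n)%N; apply: spanB.
    by apply: span_le Bf; apply: leq_addr.
  by apply: span_le Bh; apply: leq_addl.
- by exists (m + n).-1; apply: spanM.
Qed.

Lemma leads_span q b : leads B g q b -> span B g q.+1 b.
Proof.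
move=> lead_b; rewrite -(subrK (g q) b); apply/spanD/span_gen/leqnn.
exact: span_le lead_b.
Qed.

Lemma leadsM q r b d : g q * g r = g (q + r)%N ->
  leads B g q b -> leads B g r d -> leads B g (q + r) (b * d).
Proof.
move=> gqr lead_b lead_d; rewrite /leads -gqr.
have ->: b * d - g q * g r = (b - g q) * d + g q * (d - g r) by ring.
apply: spanD.
  by apply: span_le (spanM lead_b (leads_span lead_d)); lia.
by apply: span_le (spanM (span_gen (leqnn q.+1)) lead_d); lia.
Qed.

Lemma leadsB q b h : leads B g q b -> span B g q h -> leads B g q (b - h).
Proof. by move=> lead_b Bh; rewrite /leads addrAC; apply: spanB. Qed.

(** Euclidean division by an element b that is monic of weight q.  The equations
    g q * g j = g (q + j) are only asked for j < m, which matters for b = y: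
    y * y is not a generator. *)
Lemma span_division q m b f : leads B g q b ->
  (forall j, (j < m)%N -> g q * g j = g (q + j)%N) -> span B g (q + m) f ->
  exists f0 f1, [/\ span B g q f0, span B g m f1 & f = f0 + b * f1].
Proof.
move=> lead_b; elim: m f => [|m IH] f gqj.
  rewrite addn0 => Bf; exists f, 0; split=> //; first exact: span0.
  by rewrite mulr0 addr0.
rewrite addnS => -[c Bc ->]; rewrite big_ord_recr /=.
(* Replacing the top generator by b * g m costs only lower generators. *)
have Bh : span B g (q + m) (b * g m - g (q + m)%N).
  rewrite -gqj // -mulrBl.
  by apply: span_le (spanM lead_b (span_gen (leqnn m.+1))); lia.
have [|f0 [f1 [Bf0 Bf1]]] := IH (\sum_(i < q + m) c i * g i
    - c (q + m)%N * (b * g m - g (q + m)%N)) (fun j ltjm => gqj j (leqW ltjm)).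
  by apply: spanB; [exists c|apply: spanZ].
move=> eq_f; exists f0, (f1 + c (q + m)%N * g m); split=> //.
  by apply/spanD/spanZ/span_gen => //; apply: span_le Bf1.
rewrite mulrDr addrA -eq_f; ring.
Qed.

(** Expansion in base b, by repeated division. *)
Lemma span_expansion p q b f : leads B g q b ->
  (forall j, (j < p * q)%N -> g q * g j = g (q + j)%N) ->
  span B g (p.+1 * q) f ->
  exists2 d : nat -> D, forall j, span B g q (d j)
    & f = \sum_(j < p.+1) d j * b ^+ j.
Proof.
move=> lead_b; elim: p f => [|p IH] f gqj Bf.
  exists (fun=> f) => [_|]; first by rewrite mul1n in Bf.
  by rewrite big_ord_recl big_ord0 expr0 mulr1 addr0.
have [f0 [f1 [Bf0 Bf1 ->]]] := span_division lead_b gqj Bf.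
have [|d Bd ->] := IH f1 _ Bf1.
  by move=> j lt_j; apply: gqj; apply: leq_trans lt_j _; rewrite mulSn leq_addl.
exists (fun j => if j is i.+1 then d i else f0) => [[|j]//|].
rewrite [RHS]big_ord_recl /= expr0 mulr1 mulr_sumr; congr (_ + _).
by apply: eq_bigr => j _; rewrite exprS; ring.
Qed.

End Span.

Lemma powers_graded (D : comNzRingType) (B : D -> Prop) (w : D) :
  subring B -> graded B (fun n => w ^+ n).
Proof.
move=> Bring; split=> [|i j]; first by rewrite expr0.
by rewrite -exprD; apply: (@span_gen _ _ _ Bring _ (i + j)%N).
Qed.

(** * Values of expansions *)

Section Values.
Variables (D : idomainType) (v : D -> rat).

Definition valuation_on : Prop :=
  (forall f g, f != 0 -> g != 0 -> v (f * g) = v f + v g) /\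
  (forall f g, f != 0 -> g != 0 -> f + g != 0 ->
     Num.min (v f) (v g) <= v (f + g)).

Definition additive_subgroup (G : rat -> Prop) : Prop :=
  G 0 /\ forall a b, G a -> G b -> G (a - b).

Definition additive_submonoid (S : rat -> Prop) : Prop :=
  S 0 /\ forall a b, S a -> S b -> S (a + b).

Definition value_ge (c : rat) (f : D) : Prop := f != 0 -> c <= v f.

Hypothesis vval : valuation_on.

Lemma valM f g : f != 0 -> g != 0 -> v (f * g) = v f + v g.
Proof. by case: vval => + _; apply. Qed.

Lemma val1 : v 1 = 0.
Proof.
by apply: (addrI (v 1)); rewrite -valM ?oner_neq0 // mulr1 addr0.
Qed.

Lemma valN f : f != 0 -> v (- f) = v f.
Proof.
move=> f0; have N1 : (-1 : D) != 0 by rewrite oppr_eq0 oner_neq0.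
have : v (-1) + v (-1) = 0 by rewrite -valM // mulrNN mulr1 val1.
by move=> vN1; rewrite -mulN1r valM //; lra.
Qed.

Lemma valX f n : f != 0 -> v (f ^+ n) = v f *+ n.
Proof.
move=> f0; elim: n => [|n IH]; first by rewrite expr0 mulr0n val1.
by rewrite exprS mulrS valM ?expf_neq0 // IH.
Qed.

Lemma value_geD c f g : value_ge c f -> value_ge c g -> value_ge c (f + g).
Proof.
have [-> _|f0] := eqVneq f 0; first by rewrite add0r.
have [->|g0] := eqVneq g 0; first by rewrite addr0.
move=> /(_ f0) cf /(_ g0) cg fg0; case: vval => _ /(_ f g f0 g0 fg0).
by apply: le_trans; rewrite le_min cf.
Qed.

Lemma value_geM c d f g :
  value_ge c f -> value_ge d g -> value_ge (c + d) (f * g).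
Proof.
move=> cf dg; rewrite /value_ge mulf_eq0 negb_or => /andP[f0 g0].
by rewrite valM //; apply: lerD; [apply: cf|apply: dg].
Qed.

(** The value at 0 being arbitrary, the summand g may vanish; this is why the
    comparison of values is conditional. *)
Lemma val_dominant f g : f != 0 -> (g != 0 -> v f < v g) ->
  f + g != 0 /\ v (f + g) = v f.
Proof.
move=> f0; have [->|g0] := eqVneq g 0; first by rewrite addr0.
move=> /(_ isT) lt_fg; have fg0 : f + g != 0.
  by apply: contraTneq lt_fg => /addr0_eq <-; rewrite valN ?ltxx.
split=> //; apply: le_anti; case: vval => _ vD.
have := vD f g f0 g0 fg0; rewrite (min_idPl (ltW lt_fg)) => ->; rewrite andbT.
have := vD (f + g) (- g) fg0; rewrite oppr_eq0 addrK valN // => /(_ g0 f0).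
by rewrite ge_min (leNgt (v g)) lt_fg orbF.
Qed.

Lemma val_distinct f g : f != 0 -> g != 0 -> v f != v g ->
  v (f + g) = v f \/ v (f + g) = v g.
Proof.
move=> f0 g0; rewrite neq_lt => /orP[lt|lt].
  by left; case: (val_dominant f0 (fun=> lt)).
by right; rewrite addrC; case: (val_dominant g0 (fun=> lt)).
Qed.

(** Two terms of equal value would put j * v b into G for some 0 < j < p, so the
    terms have pairwise distinct values and one of them gives the value of the
    sum. *)
Lemma val_expansion (G : rat -> Prop) p (b : D) (d : nat -> D) :
  additive_subgroup G -> b != 0 ->
  (forall j, (0 < j < p)%N -> ~ G (v b *+ j)) ->
  (forall j, d j != 0 -> G (v (d j))) ->
  \sum_(j < p) d j * b ^+ j != 0 ->
  exists j, [/\ (j < p)%N, d j != 0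
    & v (\sum_(i < p) d i * b ^+ i) = v (d j) + v b *+ j].
Proof.
move=> [G0 GB] b0 Gb Gd; elim: p Gb => [|p IH] Gb.
  by rewrite big_ord0 eqxx.
have vterm j : d j != 0 -> v (d j * b ^+ j) = v (d j) + v b *+ j.
  by move=> dj0; rewrite valM ?valX // expf_neq0.
have {}IH := IH (fun j H => Gb j ltac:(lia)).
rewrite big_ord_recr /=; have [->|dp0] := eqVneq (d p) 0.
  rewrite mul0r addr0 => /IH[j [lt_jp dj0 vj]].
  by exists j; split=> //; apply: ltnW.
set s := \sum_(i < p) d i * b ^+ i in IH *.
have [->|s0] := eqVneq s 0.
  by rewrite add0r => _; exists p; rewrite vterm.
have [j [lt_jp dj0 vj]] := IH s0.
have ne_v : v s != v (d p * b ^+ p).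
  apply/eqP; rewrite vj vterm // => eq_v; apply: (Gb (p - j)%N); first lia.
  rewrite mulrnBr ?(ltnW lt_jp) //.
  have ->: v b *+ p - v b *+ j = v (d j) - v (d p) by lra.
  by apply: GB; apply: Gd.
move=> _; case: (val_distinct s0 _ ne_v) => [|->|->].
- by rewrite mulf_neq0 // expf_neq0.
- by exists j; rewrite vj; split=> //; apply: ltnW.
- by exists p; rewrite vterm.
Qed.

(** The elements b 0, b 1, ... are adjoined one at a time: b t is monic of weight
    p.+1 ^ t, so that everything of weight below p.+1 ^ t.+1 is a polynomial in
    b t of degree at most p with coefficients of weight below p.+1 ^ t.  The
    groups G t record the values already reached, S the semigroup. *)
Lemma tower_values (B : D -> Prop) (g : nat -> D) (p : nat) (b : nat -> D)
    (G : nat -> rat -> Prop) (S : rat -> Prop) :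
  subring B -> graded B g ->
  (forall t, leads B g (p.+1 ^ t) (b t)) ->
  (forall t j, (j < p * p.+1 ^ t)%N ->
     g (p.+1 ^ t)%N * g j = g (p.+1 ^ t + j)%N) ->
  (forall t, additive_subgroup (G t)) -> additive_submonoid S ->
  (forall t, b t != 0) ->
  (forall t a, G t a -> G t.+1 a) ->
  (forall t, G t.+1 (v (b t))) -> (forall t, S (v (b t))) ->
  (forall t j, (0 < j < p.+1)%N -> ~ G t (v (b t) *+ j)) ->
  (forall f, B f -> f != 0 -> G 0%N (v f) /\ S (v f)) ->
  forall t f, span B g (p.+1 ^ t) f -> f != 0 -> G t (v f) /\ S (v f).
Proof.
move=> Bring ggr lead_b gM Ggrp [S0 SD] b0 Gincr Gb Sb nGb BGS.
elim=> [|t IH] f Bf f0.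
  case: Bf f0 => c Bc ->; rewrite expn0 big_ord1.
  by case: ggr => -> _; rewrite mulr1; apply: BGS.
rewrite expnS in Bf.
have [d Bd eq_f] := span_expansion Bring ggr (lead_b t) (gM t) Bf.
rewrite eq_f in f0 *.
have Gd j : d j != 0 -> G t (v (d j)) by move/(IH _ (Bd j)) => [].
have [j [_ dj0 ->]] := val_expansion (Ggrp t) (b0 t) (nGb t) Gd f0.
have [Gdj Sdj] := IH _ (Bd j) dj0.
split; last by apply: (SD) => //; elim: (j) => // i; rewrite mulrS; apply: SD.
have [G0 GB] := Ggrp t.+1.
have GD x y : G t.+1 x -> G t.+1 y -> G t.+1 (x + y).
  by move=> Gx Gy; rewrite -(opprK y) -(sub0r y); do 2?apply: (GB) => //.
by apply: (GD); [apply: Gincr|elim: (j) => // i; rewrite mulrS; apply: GD].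
Qed.

End Values.

(** * Denominators of the values *)

Definition ternary_group (t : nat) (a : rat) : Prop := a * 3 ^+ t \is a Num.int.

(** The elements of 2^-t Z[1/3]: powers of 3 are harmless here, since all the
    Q_j have been adjoined before the first R_i. *)
Definition binary_group (t : nat) (a : rat) : Prop :=
  exists u, a * 2 ^+ t * 3 ^+ u \is a Num.int.

Lemma ternary_subgroup t : additive_subgroup (ternary_group t).
Proof.
split=> [|a b Ga Gb]; first by rewrite /ternary_group mul0r rpred0.
by rewrite /ternary_group mulrBl rpredB.
Qed.

Lemma binary_subgroup t : additive_subgroup (binary_group t).
Proof.
split=> [|a b [u Ga] [u' Gb]]; first by exists 0; rewrite !mul0r rpred0.
exists (u + u')%N.
have ->: (a - b) * 2 ^+ t * 3 ^+ (u + u') =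
    a * 2 ^+ t * 3 ^+ u * 3 ^+ u' - b * 2 ^+ t * 3 ^+ u' * 3 ^+ u.
  by rewrite exprD; ring.
by apply: rpredB; rewrite rpredM // rpredX.
Qed.

Lemma betaS i : beta i.+2 = 2 * beta i.+1 + (2 ^+ i.+2)^-1.
Proof. by []. Qed.

Lemma gammabarS i : gammabar i.+3 = 3 * gammabar i.+2 + (3 ^+ i.+2)^-1.
Proof. by []. Qed.

Lemma beta_odd i : exists m : int, beta i.+1 * 2 ^+ i.+1 = 2 * m%:~R + 1.
Proof.
elim: i => [|i [m IH]]; first by exists 1; rewrite /= expr1; lra.
have p2 : (2 : rat) ^+ i.+2 != 0 by rewrite expf_neq0.
exists (2 * (2 * m + 1)); rewrite betaS mulrDl mulVf //.
rewrite exprS mulrACA IH; ring.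
Qed.

(** The value of R_t; the initial value is that of R_0 = y. *)
Definition Rvalue (t : nat) : rat :=
  if t is t'.+1 then beta t'.+2 - 2 ^+ t' else 3 / 2.

Lemma Rvalue_odd t : exists m : int, Rvalue t * 2 ^+ t.+1 = 2 * m%:~R + 1.
Proof.
case: t => [|t]; first by exists 1; rewrite /= expr1; lra.
have [m Hm] := beta_odd t.+1; exists (m - 2 ^+ (t + t.+1)).
rewrite mulrBl Hm -exprD addnS exprS intrB rmorphXn /=; ring.
Qed.

Lemma gammabar_mod3 i :
  exists m : int, gammabar i.+2 * 3 ^+ i.+1 = 3 * m%:~R + 1.
Proof.
elim: i => [|i [m IH]]; first by exists 4; rewrite /= expr1; lra.
have p3 : (3 : rat) ^+ i.+2 != 0 by rewrite expf_neq0.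
exists (3 * (3 * m + 1)).
rewrite gammabarS mulrDl mulVf //.
rewrite exprS mulrACA IH; ring.
Qed.

Lemma Rvalue_binary t : binary_group t.+1 (Rvalue t).
Proof.
have [m Hm] := Rvalue_odd t; exists 0; rewrite Hm expr0 mulr1.
by rewrite -[2]/(2%:~R) -intrM -[1]/(1%:~R) -intrD intr_int.
Qed.

Lemma gammabar_ternary t : ternary_group t.+1 (gammabar t.+2).
Proof.
have [m Hm] := gammabar_mod3 t; rewrite /ternary_group Hm.
by rewrite -[3]/(3%:~R) -intrM -[1]/(1%:~R) -intrD intr_int.
Qed.

Lemma Rvalue_new t j : (0 < j < 2)%N -> ~ binary_group t (Rvalue t *+ j).
Proof.
case: j => [|[|j]] // _ [u /intrP[n eq_n]]; have [m Hm] := Rvalue_odd t.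
have [l Hl] : exists l : int, 3 ^+ u = 2 * l + 1.
  elim: (u) => [|i [l Hl]]; first by exists 0.
  by exists (3 * l + 1); rewrite exprS Hl; lia.
have : (2 * m + 1) * 3 ^+ u = 2 * n :> int.
  apply/eqP; rewrite -(eqr_int rat) !intrM intrD intrM rmorphXn /= -Hm -eq_n.
  by rewrite exprS mulr1n; apply/eqP; ring.
by rewrite Hl; lia.
Qed.

Lemma gammabar_new t j :
  (0 < j < 3)%N -> ~ ternary_group t (gammabar t.+2 *+ j).
Proof.
move=> lt_j /intrP[n eq_n]; have [m Hm] := gammabar_mod3 t.
have : (3 * m + 1) *+ j = 3 * n :> int.
  apply/eqP; rewrite -(eqr_int rat) -mulr_natl !intrM intrD intrM /= -Hm -eq_n.
  by rewrite exprS -mulr_natl; apply/eqP; ring.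
by move: lt_j; case: j {eq_n} => [|[|[|j]]] //= _; lia.
Qed.

Lemma ternary_binary t a : ternary_group t a -> binary_group 0 a.
Proof. by exists t; rewrite expr0 mulr1. Qed.

Lemma ternary_incr t a : ternary_group t a -> ternary_group t.+1 a.
Proof. by rewrite /ternary_group exprSr mulrA => Ga; rewrite rpredM. Qed.

Lemma binary_incr t a : binary_group t a -> binary_group t.+1 a.
Proof.
move=> [u Ga]; exists u.
have ->: a * 2 ^+ t.+1 * 3 ^+ u = 2 * (a * 2 ^+ t * 3 ^+ u).
  by rewrite exprS; ring.
by rewrite rpredM.
Qed.

(** * The polynomial ring as an iterated free module *)

(** The sequence R_1, R_2, ... of the problem, extended by R_0 = y. *)
Fixpoint Rpoly (k : fieldType) (t : nat) : {mpoly k[3]} :=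
  match t with
  | 0 => vary k
  | 1 => varz k
  | (t1.+1 as t').+1 => Rpoly k t' ^+ 2 - varx k ^+ (3 * 2 ^ t1) * Ppoly k t'
  end.

(* Simplification would unfold w = Q_2 and hide its role as an indeterminate. *)
Local Arguments Ppoly k i : simpl never.
Local Arguments Qpoly k i : simpl never.
Local Arguments Rpoly k t : simpl never.

Section Polynomials.
Variable k : fieldType.
Local Notation x := (varx k).
Local Notation y := (vary k).
Local Notation z := (varz k).
Local Notation w := (Qpoly k 2).

Definition constants (f : {mpoly k[3]}) : Prop := exists c : k, f = c%:MP.

Definition poly_x : {mpoly k[3]} -> Prop := adjoin constants (fun n => x ^+ n).

Definition poly_xw : {mpoly k[3]} -> Prop := adjoin poly_x (fun n => w ^+ n).

(** The monomial y^e z^b with e < 2 of weight n = e + 2 b. *)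
Definition yz_gen (n : nat) : {mpoly k[3]} := y ^+ odd n * z ^+ n./2.

Lemma PpolyS i : Ppoly k i.+3 =
  Ppoly k i.+2 ^+ 2 - x ^+ (5 * 2 ^ i) * Ppoly k i.+1.
Proof. by []. Qed.

Lemma QpolyS i : Qpoly k i.+4 =
  Qpoly k i.+3 ^+ 3 - x ^+ (35 * 3 ^ i) * Qpoly k i.+2.
Proof. by []. Qed.

Lemma RpolyS t : Rpoly k t.+2 =
  Rpoly k t.+1 ^+ 2 - x ^+ (3 * 2 ^ t) * Ppoly k t.+1.
Proof. by []. Qed.

Lemma y_square : y ^+ 2 = x * z + x ^+ 3 - w.
Proof. have ->: w = x * z - (y ^+ 2 - x ^+ 3) by []; ring. Qed.

Lemma constants_subring : subring constants.
Proof.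
split=> [|_ _ [a ->] [b ->]|_ _ [a ->] [b ->]].
- by exists 1; rewrite mpolyC1.
- by exists (a - b); rewrite mpolyCB.
- by exists (a * b); rewrite mpolyCM.
Qed.

Lemma poly_x_subring : subring poly_x.
Proof.
apply: adjoin_subring; first exact: constants_subring.
exact/powers_graded/constants_subring.
Qed.

Lemma poly_xw_subring : subring poly_xw.
Proof.
by apply: adjoin_subring; [|apply: powers_graded]; apply: poly_x_subring.
Qed.

Lemma poly_x_const c : poly_x c%:MP.
Proof.
exists 1%N; apply: span_coef; first exact: constants_subring.
  exact/powers_graded/constants_subring.
by exists c.
Qed.

Lemma poly_x_x : poly_x x.
Proof.
by exists 2%N; apply: (@span_gen _ _ _ constants_subring _ 1%N); rewrite ?expr1.
Qed.

Lemma poly_x_xw f : poly_x f -> poly_xw f.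
Proof.
move=> kxf; exists 1%N; apply: span_coef kxf; first exact: poly_x_subring.
exact/powers_graded/poly_x_subring.
Qed.

Lemma poly_xw_w : poly_xw w.
Proof.
by exists 2%N; apply: (@span_gen _ _ _ poly_x_subring _ 1%N); rewrite ?expr1.
Qed.

Lemma poly_xw_x : poly_xw x. Proof. exact/poly_x_xw/poly_x_x. Qed.

Lemma yz_gen_even a j : yz_gen a.*2 * yz_gen j = yz_gen (a.*2 + j).
Proof.
by rewrite /yz_gen oddD halfD odd_double doubleK /= add0n mul1r exprD; ring.
Qed.

(** Only a product of two monomials with a factor y needs reduction, and
    y^2 = x z + x^3 - w has the leading term x z, of the same weight 2 as y^2. *)
Lemma yz_graded : graded poly_xw yz_gen.
Proof.
split=> [|i j]; first by rewrite /yz_gen mulr1.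
have Bring := poly_xw_subring.
have := odd_double_half i; have := odd_double_half j.
case: (odd i); last first.
  by move=> _ <-; rewrite add0n yz_gen_even; apply: span_gen.
case: (odd j); last first.
  move=> <- _; rewrite add0n mulrC yz_gen_even addnC; exact: span_gen.
move: (i./2) (j./2) => a b <- <-.
have ->: yz_gen (true + a.*2) * yz_gen (true + b.*2) =
    x * yz_gen (a + b).+1.*2 + (x ^+ 3 - w) * yz_gen (a + b).*2.
  rewrite /yz_gen /= !doubleK !odd_double !uphalf_double /=.
  by rewrite mulrACA -expr2 y_square !expr0 !mul1r -exprD [z ^+ _.+1]exprS; ring.
have Bw : poly_xw (x ^+ 3 - w).
  by apply: subringB; [|apply: subringX; [|apply: poly_xw_x]|apply: poly_xw_w].
by apply: spanD => //; apply: spanZ => //; try exact: poly_xw_x;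
  apply: span_gen => //; lia.
Qed.

Lemma adjoin_coef a : poly_xw a -> adjoin poly_xw yz_gen a.
Proof.
by move=> Ba; exists 1%N; apply: span_coef Ba;
  [apply: poly_xw_subring|apply: yz_graded].
Qed.

Lemma yz_gen1 : yz_gen 1 = y.
Proof. by rewrite /yz_gen mulr1. Qed.

Lemma yz_gen2 : yz_gen 2 = z.
Proof. by rewrite /yz_gen mul1r. Qed.

(** The span is a subring containing the constants, x, y and z. *)
Lemma adjoin_yz_full f : adjoin poly_xw yz_gen f.
Proof.
have Mring := adjoin_subring poly_xw_subring yz_graded.
have gen i : adjoin poly_xw yz_gen (yz_gen i).
  by exists i.+1; apply: span_gen; first exact: poly_xw_subring.
elim/mpolyind: f => [|c m p _ _ Mp]; first exact: subring0.
apply: subringD => //; rewrite -mul_mpolyC; apply: subringM => //.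
  exact/adjoin_coef/poly_x_xw/poly_x_const.
rewrite mpolyXE_id; apply: (big_ind (adjoin poly_xw yz_gen)).
- exact: subring1.
- by move=> a b; apply: subringM.
move=> i _; apply: subringX => //; case: i => [[|[|[|i]]] lt_i] //.
- rewrite (bool_irrelevance lt_i isT); exact/adjoin_coef/poly_xw_x.
- rewrite (bool_irrelevance lt_i isT) -/(vary k) -yz_gen1; exact: gen.
- rewrite (bool_irrelevance lt_i isT) -/(varz k) -yz_gen2; exact: gen.
Qed.

(** Cubing triples the degree in w, and the subtracted term of the recursion has
    smaller degree. *)
Lemma Qpoly_leads t : leads poly_x (fun n => w ^+ n) (3 ^ t) (Qpoly k t.+2).
Proof.
have Bring := poly_x_subring; have ggr := powers_graded w Bring.
have lead3 q b : leads poly_x (fun n => w ^+ n) q b ->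
    leads poly_x (fun n => w ^+ n) (q + (q + q)) (b ^+ 3).
  have powM i j : w ^+ i * w ^+ j = w ^+ (i + j) by rewrite exprD.
  move=> lead_b; rewrite exprS expr2.
  exact/(leadsM Bring ggr (powM _ _) lead_b)/leadsM.
have pow3 i : (3 ^ i.+1 = 3 ^ i + (3 ^ i + 3 ^ i))%N by rewrite expnS; lia.
have lead0 : leads poly_x (fun n => w ^+ n) 1 w.
  by rewrite /leads expr1 subrr; apply: span0.
suff [] : leads poly_x (fun n => w ^+ n) (3 ^ t) (Qpoly k t.+2) /\
   leads poly_x (fun n => w ^+ n) (3 ^ t.+1) (Qpoly k t.+3) by [].
elim: t => [|t [IH0 IH1]].
  split=> //; apply: leadsB; rewrite ?pow3; [exact: Bring|exact: lead3|].
  by apply: span_coef => //; apply: subringX => //; apply: poly_x_x.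
split=> //; rewrite QpolyS pow3; apply: leadsB => //; first exact: lead3.
apply: spanZ => //; first by apply: subringX => //; apply: poly_x_x.
apply: span_le (leads_span Bring IH0); rewrite // !expnS; lia.
Qed.

(** P_i has weight 2^(i-1), since P_2 = x z - w and each recursion step squares;
    only weight below 2^(i+1) matters for the leading term of R_(i+1). *)
Lemma Ppoly_span i : span poly_xw yz_gen (2 ^ i) (Ppoly k i).
Proof.
have Bring := poly_xw_subring; have ggr := yz_graded.
suff [] : span poly_xw yz_gen (2 ^ i) (Ppoly k i) /\
  span poly_xw yz_gen (2 ^ i.+1) (Ppoly k i.+1) by [].
have P1 : span poly_xw yz_gen 2 y by rewrite -yz_gen1; apply: span_gen.
elim: i => [|i [IH0 IH1]].
  by split=> //; apply: span_coef => //; apply: poly_xw_x.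
split=> //; have le2 : (2 ^ i.+1 + 2 ^ i.+1 = 2 ^ i.+2)%N.
  by rewrite addnn -mul2n -expnS.
case: i IH0 IH1 le2 => [|i] IH0 IH1 le2.
  have ->: Ppoly k 2 = x * yz_gen 2 - w * yz_gen 0.
    have ->: w = x * z - Ppoly k 2 by [].
    by rewrite yz_gen2 /yz_gen expr0; ring.
  by apply: spanB => //; apply: spanZ; rewrite ?expn1 //;
    try exact: poly_xw_x; try exact: poly_xw_w; apply: span_gen.
rewrite PpolyS expr2; apply: spanB => //.
  by apply: span_le (spanM Bring ggr IH1 IH1); rewrite // le2 leq_pred.
apply: spanZ => //; first by apply: subringX => //; apply: poly_xw_x.
by apply: span_le IH0; rewrite // leq_exp2l // leqW.
Qed.

Lemma Rpoly_leads t : leads poly_xw yz_gen (2 ^ t) (Rpoly k t).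
Proof.
have Bring := poly_xw_subring; have ggr := yz_graded.
case: t => [|t]; first by rewrite /leads yz_gen1 subrr; apply: span0.
elim: t => [|t IH]; first by rewrite /leads yz_gen2 subrr; apply: span0.
have le2 i : (2 ^ i.+1 = 2 ^ i + 2 ^ i)%N by rewrite addnn -mul2n -expnS.
rewrite RpolyS le2 expr2; apply: leadsB => //.
  by apply: leadsM => //; rewrite expnS mul2n yz_gen_even.
apply: spanZ => //; first by apply: subringX => //; apply: poly_xw_x.
by apply: span_le (Ppoly_span t.+1); rewrite // -le2 leq_exp2l.
Qed.

(** At (0, 1, 1) the recursions reduce to taking powers, which shows that no
    P_i with i > 0, Q_i with i > 1 or R_i is the zero polynomial. *)
Definition test_point (i : 'I_3) : k := if i == 0 :> nat then 0 else 1.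

Lemma Ppoly_test i : (Ppoly k i.+1).@[test_point] = 1.
Proof.
have xt : x.@[test_point] = 0 by rewrite mevalXU.
have yt : y.@[test_point] = 1 by rewrite mevalXU.
suff [] : (Ppoly k i.+1).@[test_point] = 1 /\ (Ppoly k i.+2).@[test_point] = 1.
  by [].
elim: i => [|i [IH0 IH1]].
  split=> //; rewrite (_ : Ppoly k 2 = y ^+ 2 - x ^+ 3) // mevalB !rmorphXn /=.
  by rewrite xt yt !expr0n subr0 expr1n.
split=> //; rewrite PpolyS mevalB rmorphXn mevalM rmorphXn /= -/(Ppoly k i.+1).
by rewrite IH1 xt expr1n expr0n muln_eq0 expn_eq0 /= mul0r subr0.
Qed.

Lemma Rpoly_test t : (Rpoly k t).@[test_point] = 1.
Proof.
have xt : x.@[test_point] = 0 by rewrite mevalXU.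
case: t => [|t]; first by rewrite mevalXU.
elim: t => [|t IH]; first by rewrite mevalXU.
rewrite RpolyS mevalB rmorphXn mevalM rmorphXn /= IH xt.
by rewrite expr1n expr0n muln_eq0 expn_eq0 /= mul0r subr0.
Qed.

Lemma Qpoly_test i : (Qpoly k i.+2).@[test_point] = -1.
Proof.
have xt : x.@[test_point] = 0 by rewrite mevalXU.
have w_t : w.@[test_point] = -1.
  by rewrite mevalB mevalM xt mul0r Ppoly_test sub0r.
suff [] : (Qpoly k i.+2).@[test_point] = -1 /\
  (Qpoly k i.+3).@[test_point] = -1 by [].
elim: i => [|i [IH0 IH1]].
  split=> //; rewrite (_ : Qpoly k 3 = w ^+ 3 - x ^+ 13) // mevalB !rmorphXn /=.
  rewrite w_t xt expr0n /=; ring.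
split=> //; rewrite QpolyS mevalB rmorphXn mevalM rmorphXn /= IH1 xt.
rewrite (expr0n _ (35 * 3 ^ i)) muln_eq0 expn_eq0 /=; ring.
Qed.

Lemma Ppoly_neq0 i : Ppoly k i.+1 != 0.
Proof.
by apply: contra_eq_neq (Ppoly_test i) => ->; rewrite meval0 eq_sym oner_neq0.
Qed.

Lemma Rpoly_neq0 t : Rpoly k t != 0.
Proof.
by apply: contra_eq_neq (Rpoly_test t) => ->; rewrite meval0 eq_sym oner_neq0.
Qed.

Lemma Qpoly_neq0 i : Qpoly k i.+2 != 0.
Proof.
apply: contra_eq_neq (Qpoly_test i) => ->.
by rewrite meval0 eq_sym oppr_eq0 oner_neq0.
Qed.

Lemma x_neq0 : x != 0.
Proof.
apply/eqP => x0; have := mevalXU (fun=> 1 : k) (@Ordinal 3 0 isT).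
by rewrite -/(varx k) x0 meval0 => /eqP; rewrite eq_sym oner_eq0.
Qed.

End Polynomials.

(** * The value semigroup *)

Section ValueSemigroup.
Variables (k : fieldType) (nu : {fraction {mpoly k[3]}} -> rat).
Hypotheses (nu_val : is_valuation nu) (nu_dom : dominates_local_ring nu).

Definition poly_value (p : {mpoly k[3]}) : rat := nu (FracField.tofrac p).

Lemma poly_valuation : valuation_on poly_value.
Proof.
have nz (p : {mpoly k[3]}) : p != 0 -> FracField.tofrac p != 0.
  by rewrite tofrac_eq0.
case: nu_val => vM vD; split=> [f g /nz f0 /nz g0|f g /nz f0 /nz g0 /nz fg0].
  have fM := tofracM f g; rewrite /poly_value fM; exact (vM _ _ f0 g0).
have fD := tofracD f g; rewrite fD in fg0; rewrite /poly_value fD.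
exact (vD _ _ f0 g0 fg0).
Qed.

Lemma const_notin_ideal (c : k) : c != 0 -> ~ ideal_xyz (c%:MP : {mpoly k[3]}).
Proof.
move=> c0 [a [b [d /(congr1 (meval (fun=> 0)))]]].
rewrite mevalC !mevalD !mevalM !mevalXU !mulr0 !addr0 => c_eq0.
by rewrite c_eq0 eqxx in c0.
Qed.

Lemma one_notin_ideal : ~ ideal_xyz (1 : {mpoly k[3]}).
Proof. by rewrite -mpolyC1; apply/const_notin_ideal/oner_neq0. Qed.

(** Both q and its inverse belong to the local ring, so nu is nonnegative at
    both. *)
Lemma value_unit q : ~ ideal_xyz q -> poly_value q = 0.
Proof.
move=> q_unit; have q0 : FracField.tofrac q != 0.
  rewrite tofrac_eq0; apply/eqP => q0; apply: q_unit; exists 0, 0, 0.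
  by rewrite q0 !mul0r !addr0.
have q_in : local_ring (FracField.tofrac q).
  exists q, 1; split; first exact: one_notin_ideal.
  by rewrite tofrac1 divr1.
have qV_in : local_ring (FracField.tofrac q)^-1.
  by exists 1, q; split=> //; rewrite tofrac1 div1r.
have qV0 : (FracField.tofrac q)^-1 != 0 by rewrite invr_eq0.
have [ge0 _] := nu_dom q0 q_in; have [Vge0 _] := nu_dom qV0 qV_in.
have := val1 poly_valuation; rewrite /poly_value tofrac1 -(divff q0).
rewrite (nu_val.1 _ _ q0 qV0) => /eqP; rewrite addr_eq0 => /eqP eq_nu.
by apply: le_anti; rewrite ge0 eq_nu oppr_le0 Vge0.
Qed.

(** Denominators are units and have value 0. *)
Lemma value_semigroupP s :
  value_semigroup nu s <-> exists2 p, p != 0 & s = poly_value p.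
Proof.
split=> [[f [f0 [p [q [q_unit eq_f]]] ->]]|[p p0 ->]].
  move: f0; rewrite {}eq_f mulf_eq0 invr_eq0 negb_or => /andP[p0 q0].
  exists p; first by move: p0; rewrite tofrac_eq0.
  have := value_unit q_unit; rewrite /poly_value => nu_q.
  have qV0 : (FracField.tofrac q)^-1 != 0 by rewrite invr_eq0.
  have := nu_val.1 _ _ (mulf_neq0 p0 qV0) q0.
  by rewrite (divfK q0) nu_q addr0 => ->.
exists (FracField.tofrac p); split=> //; first by rewrite tofrac_eq0.
by exists p, 1; split; [exact: one_notin_ideal|rewrite tofrac1 divr1].
Qed.

Lemma value_submonoid : additive_submonoid (value_semigroup nu).
Proof.
split.
  by apply/value_semigroupP; exists 1; rewrite ?oner_neq0 ?(val1 poly_valuation).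
move=> a b /value_semigroupP[p p0 ->] /value_semigroupP[q q0 ->].
apply/value_semigroupP; exists (p * q); first by rewrite mulf_neq0.
by rewrite (valM poly_valuation).
Qed.

Hypothesis nuP : forall i, nu (FracField.tofrac (Ppoly k i)) = beta i.
Hypothesis nuQ : forall i, (1 <= i)%N ->
  nu (FracField.tofrac (Qpoly k i)) = gammabar i.

Lemma value_x : poly_value (varx k) = 1.
Proof. exact (nuP 0). Qed.

Lemma value_Ppoly i : poly_value (Ppoly k i) = beta i.
Proof. exact: nuP. Qed.

Lemma value_Qpoly i : poly_value (Qpoly k i.+2) = gammabar i.+2.
Proof. exact: nuQ. Qed.

(** Squaring the congruence for t gives the one for t + 1, with error term
    E * (2 P_(t+2) + E).  The value of E exceeds beta_(t+2) by at least
    5/6 + 2^-(t+2): the excess is 13/12 for E = Q_2, and since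
    beta_(t+3) = 2 beta_(t+2) + 2^-(t+3) it loses at most 2^-(t+3) at each
    step. *)
Lemma Rpoly_Ppoly t : exists E,
  varx k ^+ (2 ^ t) * Rpoly k t.+1 = Ppoly k t.+2 + E /\
  value_ge poly_value (beta t.+2 + 5 / 6 + (2 ^+ t.+2)^-1) E.
Proof.
elim: t => [|t [E [eq_R ge_E]]].
  exists (Qpoly k 2); split; first by rewrite expn0 expr1 addrC subrK.
  have b2 : beta 2 = 2 * (3 / 2) + (2 ^+ 2)^-1 by [].
  have g2 : gammabar 2 = 13 / 3 by [].
  by move=> _; rewrite value_Qpoly b2 g2 expr2; lra.
have gt0 : (0 : rat) < (2 ^+ t.+3)^-1 by rewrite invr_gt0 exprn_gt0.
have eq2 : (2 ^+ t.+2)^-1 = 2 * (2 ^+ t.+3)^-1 :> rat.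
  by rewrite [2 ^+ t.+3]exprS [in RHS]invfM mulVKf.
exists (E * (Ppoly k t.+2 + Ppoly k t.+2 + E)); split.
  (* x^(2^(t+1)) times x^(3 2^t) is the factor x^(5 2^t) in P_(t+3). *)
  have exp5 : (5 * 2 ^ t = 2 ^ t + 2 ^ t + 3 * 2 ^ t)%N by lia.
  rewrite PpolyS RpolyS exp5 expnS mul2n -addnn !exprD.
  have sq : (varx k ^+ (2 ^ t) * Rpoly k t.+1) ^+ 2 =
      (Ppoly k t.+2 + E) ^+ 2 by rewrite eq_R.
  by rewrite mulrBr; move: sq; rewrite exprMn => sq; ring: sq.
have geP : value_ge poly_value (beta t.+2) (Ppoly k t.+2).
  by move=> _; rewrite value_Ppoly.
have geE : value_ge poly_value (beta t.+2) E.
  by move=> /ge_E; apply: le_trans; lra.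
move=> /(value_geM poly_valuation ge_E
  (value_geD poly_valuation (value_geD poly_valuation geP geP) geE)).
apply: le_trans; rewrite betaS eq2; lra.
Qed.

Lemma value_Rpoly t : poly_value (Rpoly k t) = Rvalue t.
Proof.
case: t => [|t]; first exact: (value_Ppoly 1).
have [E [eq_R ge_E]] := Rpoly_Ppoly t.
have gt0 : (0 : rat) < (2 ^+ t.+2)^-1 by rewrite invr_gt0 exprn_gt0.
have [|_] := val_dominant poly_valuation (g := E) (Ppoly_neq0 k t.+1).
  by rewrite value_Ppoly => /ge_E; apply: lt_le_trans; lra.
rewrite -eq_R value_Ppoly (valM poly_valuation) ?Rpoly_neq0 ?expf_neq0 ?x_neq0 //.
rewrite (valX poly_valuation) ?x_neq0 // value_x /= natrX => <-.
by rewrite addrC addKr.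
Qed.

(** The powers of x have distinct values and nonzero constants have value 0: this
    is [val_expansion] with the trivial group. *)
Lemma value_poly_x f : poly_x f -> f != 0 -> exists n, poly_value f = n%:R.
Proof.
move=> [n [c Kc ->]] f0.
have G0 : additive_subgroup (fun a => a = 0).
  by split=> // a b -> ->; rewrite subr0.
have [] := val_expansion (p := n) (b := varx k) (d := c) poly_valuation G0.
- exact: x_neq0.
- by case=> // j _ /eqP; rewrite value_x pnatr_eq0.
- move=> j; case: (Kc j) => a ->; rewrite mpolyC_eq0 => a0.
  exact/value_unit/const_notin_ideal.
- by [].
move=> j [_ cj0 ->]; exists j; rewrite value_x.
case: (Kc j) cj0 => a ->; rewrite mpolyC_eq0 => a0.
by rewrite value_unit ?add0r //; apply: const_notin_ideal.
Qed.

Section Inclusion.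
Variable S : rat -> Prop.
Hypotheses (Smon : additive_submonoid S) (S1 : S 1).
Hypotheses (SR : forall t, S (Rvalue t)) (SQ : forall t, S (gammabar t.+2)).

Lemma value_poly_xw f : poly_xw f -> f != 0 ->
  binary_group 0 (poly_value f) /\ S (poly_value f).
Proof.
move=> [n Bf] f0; have Bring := poly_x_subring k.
(* Any weight n is below some power of 3. *)
have {}Bf := span_le Bring (ltnW (ltn_expl n (isT : (1 < 3)%N))) Bf.
have [] := tower_values (p := 2) (b := fun t => Qpoly k t.+2)
    (G := ternary_group) poly_valuation Bring (powers_graded _ Bring)
    (@Qpoly_leads k) _ ternary_subgroup Smon (@Qpoly_neq0 k) ternary_incr
    _ _ _ _ Bf f0.
- by move=> t j _; rewrite -exprD.
- by move=> t; rewrite value_Qpoly; apply: gammabar_ternary.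
- by move=> t; rewrite value_Qpoly.
- by move=> t j; rewrite value_Qpoly; apply: gammabar_new.
- move=> g Bg g0; have [m ->] := value_poly_x Bg g0; split.
    by rewrite /ternary_group expr0 mulr1 natr_int.
  by case: Smon => S0 SD; elim: m => // m IH; rewrite mulrS; apply: SD.
by move=> /ternary_binary.
Qed.

Lemma value_poly f : f != 0 -> S (poly_value f).
Proof.
move=> f0; have [n Bf] := adjoin_yz_full f; have Bring := poly_xw_subring k.
have {}Bf := span_le Bring (ltnW (ltn_expl n (isT : (1 < 2)%N))) Bf.
have [] // := tower_values (p := 1) (b := Rpoly k)
    (G := binary_group) poly_valuation Bring (yz_graded k)
    (@Rpoly_leads k) _ binary_subgroup Smon (@Rpoly_neq0 k) binary_incr
    _ _ _ value_poly_xw Bf f0.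
- case=> [|t] j; last by rewrite expnS mul2n yz_gen_even.
  rewrite mul1n ltnS leqn0 => /eqP ->.
  by rewrite (yz_graded k).1 mulr1 addn0.
- by move=> t; rewrite value_Rpoly; apply: Rvalue_binary.
- by move=> t; rewrite value_Rpoly.
- by move=> t j; rewrite value_Rpoly; apply: Rvalue_new.
Qed.

End Inclusion.

Lemma generator_value s : generators s -> value_semigroup nu s.
Proof.
case=> [->|->|[[//|i] _ ->]|[[//|[//|i]] _ ->]]; apply/value_semigroupP.
- by exists (varx k); rewrite ?x_neq0 ?value_x.
- by exists (Rpoly k 0); rewrite ?Rpoly_neq0 ?value_Rpoly.
- by exists (Rpoly k i.+1); rewrite ?Rpoly_neq0 ?value_Rpoly.
- by exists (Qpoly k i.+2); rewrite ?Qpoly_neq0 // value_Qpoly.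
Qed.

End ValueSemigroup.

Lemma generated_submonoid (T : rat -> Prop) :
  additive_submonoid (semigroup_generated T).
Proof.
split=> [|_ _ [l [Tl ->]] [l' [Tl' ->]]]; first by exists [::]; rewrite big_nil.
exists (l ++ l'); split=> [c|]; last by rewrite big_cat.
by rewrite mem_cat => /orP[/Tl|/Tl'].
Qed.

Lemma generated_gen (T : rat -> Prop) s : T s -> semigroup_generated T s.
Proof.
move=> Ts; exists [:: (1%N, s)]; split=> [c|]; last by rewrite big_seq1.
by rewrite inE => /eqP ->.
Qed.

Lemma generated_sub (T S : rat -> Prop) s : additive_submonoid S ->
  (forall a, T a -> S a) -> semigroup_generated T s -> S s.
Proof.
move=> [S0 SD] TS [l [Tl ->]]; rewrite big_seq; apply: big_ind => // c /Tl Tc.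
by elim: (c.1) => // n IH; rewrite mulrS; apply: (SD) => //; apply: TS.
Qed.

Theorem theorem7p10 (k : fieldType) (nu : {fraction {mpoly k[3]}} -> rat)
    (nu_val : is_valuation nu)
    (nu_dom : dominates_local_ring nu)
    (nuP : forall i : nat, nu (FracField.tofrac (Ppoly k i)) = beta i)
    (nuQ : forall i : nat, (1 <= i)%N ->
       nu (FracField.tofrac (Qpoly k i)) = gammabar i) :
  forall s : rat, value_semigroup nu s <-> semigroup_generated generators s.
Proof.
move=> s; split; last first.
  apply: generated_sub; first exact: value_submonoid.
  exact: generator_value.
move=> /(value_semigroupP nu_val nu_dom)[p p0 ->].
apply: value_poly => //; first exact: generated_submonoid.
- by apply: generated_gen; constructor 1.
- case=> [|t]; apply: generated_gen; first by constructor 2.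
  by constructor 3; exists t.+1.
- by move=> t; apply: generated_gen; constructor 4; exists t.+2.
Qed.
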